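(* Let $H$ and $K$ be complex infinite-dimensional separable Hilbert spaces, and let $A\in B(H)$, $B\in B(K)$. Then $$\bigcap_{C\in \Phi(K,H)}\sigma(M_{C})=\bigcap_{C\in G(K,H)}\sigma(M_{C})=\bigcap_{C\in B(K,H)}\sigma(M_{C})$$ $$=\sigma_{l}(A)\cup \sigma_{r}(B)\cup\{\lambda\in \mathbb{C}: \alpha(B-\lambda)\neq\beta(A-\lambda)\}.$$
   Context: $B(H,K)$ is the set of bounded linear operators from $H$ to $K$, and $B(H)=B(H,H)$. For $T\in B(H,K)$, $N(T)$ and $R(T)$ are its kernel and range, $\alpha(T)=\dim N(T)$ and $\beta(T)=\dim (K/R(T))$; any infinite dimension is written $\infty$, i.e. $\alpha(T),\beta(T)\in\{0,1,2,\dots\}\cup\{\infty\}$, so two infinite values are considered equal. $T$ is Fredholm if $R(T)$ is closed, $\alpha(T)<\infty$ and $\beta(T)<\infty$. $G(K,H)$ and $\Phi(K,H)$ denote the sets of invertible operators and of Fredholm operators from $K$ to $H$. For an operator $T$ on a Hilbert space: $\sigma(T)$, $\sigma_l(T)$, $\sigma_r(T)$ are the sets of $\lambda\in\mathbb{C}$ such that $T-\lambda I$ is not invertible, not left invertible, not right invertible, respectively (inverses being bounded linear operators). $T-\lambda$ means $T-\lambda I$. For $C\in B(K,H)$, $M_C=\begin{pmatrix}A&C\\0&B\end{pmatrix}\in B(H\oplus K)$, i.e. $M_C(x,y)=(Ax+Cy,By)$. *)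

(* Defs.v *)
From HB Require Import structures.
From mathcomp Require Import all_boot all_order all_algebra.
From mathcomp Require Import all_classical all_reals all_analysis.
From mathcomp.real_closed Require Import complex.
From mathcomp Require Import ring.
Import numFieldNormedType.Exports.
Import Order.TTheory GRing.Theory Num.Theory.

Set Implicit Arguments.
Unset Strict Implicit.
Unset Printing Implicit Defensive.

Local Open Scope classical_set_scope.
Local Open Scope ring_scope.
Local Open Scope complex_scope.

(* Complex Hilbert spaces; [inner] is linear in its first argument and
   conjugate-linear in its second one. *)
HB.mixin Record CompleteNormedModule_isHilbert (R : realType) H
    & CompleteNormedModule R[i] H := {
  inner : {dot H for (@Num.conj R[i])} ;
  inner_norm : forall x : H, inner x x = `|x| ^+ 2
}.

#[short(type="hilbertType")]
HB.structure Definition Hilbert (R : realType) :=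
  {H of CompleteNormedModule R[i] H & CompleteNormedModule_isHilbert R H}.

(* The Hilbert space direct sum. It is an alias of the product type because the
   library norm on the latter is the max norm, which is not Hilbertian. *)
Definition hsum (R : realType) (H K : hilbertType R) : Type := (H * K)%type.

Section hsum.
Variables (R : realType) (H K : hilbertType R).
Local Notation hsumHK := (hsum H K).

HB.instance Definition _ := GRing.Lmodule.copy hsumHK (H * K)%type.

Definition hsum_norm (z : hsumHK) : R[i] :=
  sqrtC (`|z.1| ^+ 2 + `|z.2| ^+ 2).

Lemma hsum_norm_sqr z : hsum_norm z ^+ 2 = `|z.1| ^+ 2 + `|z.2| ^+ 2.
Proof. exact: sqrtCK. Qed.

Lemma hsum_norm_ge0 z : 0 <= hsum_norm z.
Proof. by rewrite sqrtC_ge0 addr_ge0// exprn_ge0. Qed.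

Lemma hsum_normD x y : hsum_norm (x + y) <= hsum_norm x + hsum_norm y.
Proof.
rewrite -ler_sqr ?nnegrE ?addr_ge0 ?hsum_norm_ge0// sqrrD !hsum_norm_sqr.
set a := `|x.1|; set b := `|x.2|; set c := `|y.1|; set d := `|y.2|.
have [a0 b0] : 0 <= a /\ 0 <= b by split; exact: normr_ge0.
have [c0 d0] : 0 <= c /\ 0 <= d by split; exact: normr_ge0.
have le_ac : `|(x + y).1| ^+ 2 <= (a + c) ^+ 2.
  by rewrite ler_sqr ?nnegrE ?addr_ge0// ler_normD.
have le_bd : `|(x + y).2| ^+ 2 <= (b + d) ^+ 2.
  by rewrite ler_sqr ?nnegrE ?addr_ge0// ler_normD.
apply: le_trans (lerD le_ac le_bd) _.
have cs : a * c + b * d <= hsum_norm x * hsum_norm y.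
  rewrite -ler_sqr ?nnegrE ?mulr_ge0 ?addr_ge0 ?mulr_ge0 ?hsum_norm_ge0//.
  rewrite exprMn !hsum_norm_sqr -/a -/b -/c -/d -subr_ge0.
  have -> : (a ^+ 2 + b ^+ 2) * (c ^+ 2 + d ^+ 2) - (a * c + b * d) ^+ 2 =
            (a * d - b * c) ^+ 2 by ring.
  by apply: real_exprn_even_ge0 => //; rewrite rpredB// ger0_real// mulr_ge0.
rewrite -subr_ge0.
have -> : a ^+ 2 + b ^+ 2 + hsum_norm x * hsum_norm y *+ 2 + (c ^+ 2 + d ^+ 2)
    - ((a + c) ^+ 2 + (b + d) ^+ 2) =
    (hsum_norm x * hsum_norm y - (a * c + b * d)) *+ 2 by ring.
by rewrite mulrn_wge0// subr_ge0.
Qed.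

Lemma hsum_normZ (l : R[i]) x : hsum_norm (l *: x) = `|l| * hsum_norm x.
Proof.
rewrite /hsum_norm /= !normrZ !exprMn -mulrDr sqrtCM ?nnegrE ?exprn_ge0//.
by rewrite exprCK.
Qed.

Lemma hsum_norm_eq0 x : hsum_norm x = 0 -> x = 0.
Proof.
move=> /eqP; rewrite sqrtC_eq0 paddr_eq0 ?exprn_ge0// !sqrf_eq0 !normr_eq0.
by case: x => a b /= /andP[/eqP-> /eqP->].
Qed.

HB.instance Definition _ :=
  Lmodule_isNormed.Build R[i] hsumHK hsum_normD hsum_normZ hsum_norm_eq0.

Lemma hsum_normE (z : hsumHK) : `|z| = hsum_norm z. Proof. by []. Qed.

Lemma hsum_norm1 (z : hsumHK) : `|z.1| <= `|z|.
Proof.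
by rewrite hsum_normE -ler_sqr ?nnegrE ?hsum_norm_ge0// hsum_norm_sqr lerDl
  exprn_ge0.
Qed.

Lemma hsum_norm2 (z : hsumHK) : `|z.2| <= `|z|.
Proof.
by rewrite hsum_normE -ler_sqr ?nnegrE ?hsum_norm_ge0// hsum_norm_sqr lerDr
  exprn_ge0.
Qed.

Lemma hsum_norm_le (z : hsumHK) : `|z| <= `|z.1| + `|z.2|.
Proof.
rewrite hsum_normE -ler_sqr ?nnegrE ?addr_ge0 ?hsum_norm_ge0//.
by rewrite hsum_norm_sqr sqrrD addrAC lerDl mulrn_wge0// mulr_ge0.
Qed.

Lemma hsum_complete (F : set_system hsumHK) :
  ProperFilter F -> cauchy F -> cvg F.
Proof.
move=> FF /cauchy_ballP cF.
have cvg1 : cvg ((fun z : hsumHK => z.1) @ F).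
  apply: cauchy_cvg; apply/cauchy_ballP => e e0; rewrite near_map2.
  apply: filterS (cF e e0) => -[x y]; rewrite -!ball_normE /ball_/=.
  exact: le_lt_trans (hsum_norm1 (x - y)).
have cvg2 : cvg ((fun z : hsumHK => z.2) @ F).
  apply: cauchy_cvg; apply/cauchy_ballP => e e0; rewrite near_map2.
  apply: filterS (cF e e0) => -[x y]; rewrite -!ball_normE /ball_/=.
  exact: le_lt_trans (hsum_norm2 (x - y)).
move: cvg1 cvg2 => /cvg_ex[/= l1 Fl1] /cvg_ex[/= l2 Fl2].
apply/cvg_ex; exists ((l1, l2) : hsumHK).
apply/cvgrPdist_lt => e e0; have e20 : 0 < e / 2 by rewrite divr_gt0.
near=> z; apply: le_lt_trans (hsum_norm_le _) _.
rewrite [ltRHS]splitr ltrD//=.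
  by near: z; move/cvgrPdist_lt: Fl1; apply.
by near: z; move/cvgrPdist_lt: Fl2; apply.
Unshelve. all: by end_near. Qed.

HB.instance Definition _ := Uniform_isComplete.Build hsumHK hsum_complete.

Definition hsum_inner (z w : hsumHK) : R[i] :=
  inner z.1 w.1 + inner z.2 w.2.

Lemma hsum_inner_bilinear :
  bilinear_for ( *%R : GRing.Scale.law R[i] R[i])
    ((@Num.conj R[i]) \; *%R : GRing.Scale.law R[i] R[i]) hsum_inner.
Proof.
split=> [w|z] a x y; rewrite /hsum_inner/=.
  by rewrite !linearPl/= mulrDr addrACA.
by rewrite !linearPr/= mulrDr addrACA.
Qed.

HB.instance Definition _ := bilinear_isBilinear.Build R[i] hsumHK hsumHK R[i]
  _ _ hsum_inner hsum_inner_bilinear.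

Lemma hsum_inner_hermitian (z w : hsumHK) :
  hsum_inner z w = (-1) ^+ false * (hsum_inner w z)^*%R.
Proof.
by rewrite expr0 mul1r /hsum_inner rmorphD/=; congr (_ + _); rewrite hermC/=
  expr0 mul1r.
Qed.

HB.instance Definition _ := isHermitianSesquilinear.Build R[i] hsumHK
  false (@Num.conj R[i]) hsum_inner hsum_inner_hermitian.

Lemma hsum_inner_norm (z : hsumHK) : hsum_inner z z = `|z| ^+ 2.
Proof. by rewrite hsum_normE hsum_norm_sqr /hsum_inner !inner_norm. Qed.

Lemma hsum_inner_gt0 (z : hsumHK) : z != 0 -> 0 < hsum_inner z z.
Proof. by move=> z0; rewrite hsum_inner_norm exprn_gt0// normr_gt0. Qed.

HB.instance Definition _ :=
  isDotProduct.Build R[i] hsumHK hsum_inner hsum_inner_gt0.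

HB.instance Definition _ :=
  CompleteNormedModule_isHilbert.Build R hsumHK hsum_inner_norm.

End hsum.

Section dimension.
Variables (R : realType) (E : lmodType R[i]).

(* The classes of the [v i] are linearly independent in [E / W]. *)
Definition indep_mod (W : set E) (n : nat) (v : 'I_n -> E) :=
  forall c : 'I_n -> R[i], W (\sum_(i < n) c i *: v i) -> forall i, c i = 0.

(* Dimension of the image of the subspace [V] in [E / W], any infinite dimension
   being [+oo]. It is [dim V] when [W] is the zero subspace, and [dim (E / W)]
   when [V] is the whole space. *)
Definition dim_mod (V W : set E) : \bar R :=
  ereal_sup [set n%:R%:E | n in
    [set n : nat | exists2 v : 'I_n -> E, forall i, V (v i) & indep_mod W v]].

Definition infinite_dimensional := dim_mod setT [set 0] = +oo%E.

End dimension.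
Arguments infinite_dimensional {R} E.

Definition separable (T : topologicalType) :=
  exists2 D : set T, countable D & dense D.

Section operators.
Variables (R : realType) (H K : hilbertType R).
Implicit Types T : {linear H -> K}.

Definition bounded_ops : set {linear H -> K} :=
  [set T | exists M : R, forall x, `|T x| <= M%:C * `|x|].

Definition ker T : set H := T @^-1` [set 0].

Definition nullity T : \bar R := dim_mod (ker T) [set 0].

(* The range is not assumed to be closed: this is the algebraic codimension. *)
Definition defect T : \bar R := dim_mod setT (range T).

Definition fredholm_ops : set {linear H -> K} :=
  [set T | [/\ bounded_ops T, closed (range T),
               (nullity T < +oo)%E & (defect T < +oo)%E]].

End operators.
Arguments bounded_ops {R} H K.
Arguments fredholm_ops {R} H K.

Section inverses.
Variables (R : realType) (H K : hilbertType R).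
Implicit Types T : {linear H -> K}.

Definition left_invertible T :=
  exists2 S : {linear K -> H}, bounded_ops K H S & S \o T = idfun.

Definition right_invertible T :=
  exists2 S : {linear K -> H}, bounded_ops K H S & T \o S = idfun.

Definition invertible T :=
  exists2 S : {linear K -> H}, bounded_ops K H S &
    S \o T = idfun /\ T \o S = idfun.

Definition invertible_ops : set {linear H -> K} :=
  [set T | bounded_ops H K T /\ invertible T].

End inverses.
Arguments invertible_ops {R} H K.

Section spectra.
Variables (R : realType) (H : hilbertType R).
Implicit Types (T : {linear H -> H}) (l : R[i]).

(* [T - l I] *)
Definition shift_op T l : {linear H -> H} := T \- l \*: idfun.

Definition spectrum T : set R[i] := [set l | ~ invertible (shift_op T l)].

Definition left_spectrum T : set R[i] :=
  [set l | ~ left_invertible (shift_op T l)].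

Definition right_spectrum T : set R[i] :=
  [set l | ~ right_invertible (shift_op T l)].

End spectra.

Section upper_triangular.
Variables (R : realType) (H K : hilbertType R).
Variables (A : {linear H -> H}) (C : {linear K -> H}) (B : {linear K -> K}).

Definition upper_op (z : hsum H K) : hsum H K := (A z.1 + C z.2, B z.2).

Lemma upper_op_linear : linear upper_op.
Proof.
move=> a [x1 y1] [x2 y2]; rewrite /upper_op/= !linearP/=.
by congr (_, _); rewrite /= scalerDr addrACA.
Qed.

HB.instance Definition _ :=
  GRing.isLinear.Build R[i] (hsum H K) (hsum H K) *:%R upper_op upper_op_linear.

End upper_triangular.

(* Main.v *)
Require Import Defs.
From HB Require Import structures.
From mathcomp Require Import all_boot all_order all_algebra.
From mathcomp Require Import all_classical all_reals all_analysis.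
From mathcomp.real_closed Require Import complex.
Import numFieldNormedType.Exports.
Import Order.TTheory GRing.Theory Num.Theory.
Local Open Scope classical_set_scope.
Local Open Scope ring_scope.
Local Open Scope complex_scope.

(** Every intersection shrinks when the set of operators [C] grows, and an
    invertible operator is Fredholm, so that
      [bigcap over B(K,H)] <= [bigcap over Phi(K,H)] <= [bigcap over G(K,H)].
    Writing [Sigma] for the set on the right of the last equality, it is enough
    to show that [Sigma] lies in the smallest of the three intersections and
    that the largest one lies in [Sigma]. Replacing [A], [B] by [A - l],
    [B - l], this is a statement about the invertibility of [M_C] itself.

    If [M_C] is invertible, the corner blocks of its inverse are a left inverse
    of [A] and a right inverse of [B], and [C] induces a linear bijection from
    [ker B] onto [H / range A]; thus the nullity of [B] is the defect of [A]
    ([upper_op_invertible]).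

    Conversely let [A1 A = 1], [B B1 = 1] and let the nullity of [B] equal the
    defect of [A]. Then [P = 1 - A A1] is a projection onto a complement of
    [range A], and [Q = 1 - B1 B] is a projection onto [ker B]. Both ranges are
    closed and have the same dimension, hence there is an isomorphism
    [T : range Q -> range P], with inverse [S]; since [H] and [K] are separable
    and infinite-dimensional there is also an isomorphism [U : K -> H]. The
    operator [C = A U B + T Q] glues [U], transported to the complements
    [range B1] and [range A], to [T]. It is invertible, with inverse
    [B1 U^-1 A1 + S P], and [M_C] has the inverse
      [(h, k) |-> (A1 h - U k, B1 k + S P h)]
    ([ex_invertible_completion]).

    The isomorphisms come from orthonormal bases. In the range [V] of a bounded
    projection of a separable space, the images of a dense sequence determine
    the vectors of [V], and a Gram-Schmidt process run on them yields a basis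
    [e] of [V] ([ex_hilbert_basis]). It is arranged so that [e n] is a unit
    vector when [n] is less than the dimension of [V] and [0] otherwise: finite
    and infinite dimensions are then treated alike, and bases of two spaces of
    the same dimension match index by index. The isomorphism sends [x] to the
    vector having in one basis the coefficients of [x] in the other; the vector
    exists by the Riesz-Fischer theorem and is unique because the second basis
    is total ([ex_transfer], [ex_isomorphism]). *)

Set Implicit Arguments.
Unset Strict Implicit.

(** * Inner products *)

Section inner_product.
Variables (R : realType) (H : hilbertType R).
Implicit Types x y z : H.

Lemma inner_conj x y : inner y x = (inner x y)^*%R.
Proof. by rewrite hermC expr0 mul1r. Qed.

Lemma inner_eq0C {x y} : inner x y = 0 -> inner y x = 0.
Proof. by rewrite (inner_conj x y) => ->; rewrite rmorph0. Qed.

Lemma inner_self_eq0 x : inner x x = 0 -> x = 0.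
Proof. by move/eqP; rewrite dnorm_eq0 => /eqP. Qed.

Lemma pythagoras x y : inner x y = 0 -> `|x + y| ^+ 2 = `|x| ^+ 2 + `|y| ^+ 2.
Proof. by move=> xy; rewrite -!inner_norm hnormDd. Qed.

(** Cauchy-Schwarz: by Pythagoras, [x] is at least as long as its component
    [c *: y] along [y]. *)
Lemma inner_le_norm x y : `|inner x y| <= `|x| * `|y|.
Proof.
have [->|y0] := eqVneq y 0; first by rewrite linear0r !normr0 mulr0.
have yy0 : `|y| ^+ 2 != 0 by rewrite expf_neq0 ?normr_eq0.
pose c := inner x y / `|y| ^+ 2.
have ort : inner (x - c *: y) (c *: y) = 0.
  rewrite linearZr_LR/= linearBl/= linearZl_LR/= inner_norm /c mulfVK//.
  by rewrite subrr mulr0.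
have := pythagoras ort; rewrite subrK normrZ exprMn => xE.
have -> : inner x y = c * `|y| ^+ 2 by rewrite mulfVK.
rewrite normrM normrX normr_id expr2 mulrA ler_wpM2r//.
by rewrite -ler_sqr ?nnegrE ?mulr_ge0// exprMn xE lerDr exprn_ge0.
Qed.

(** Continuity of the inner product, for functions that are eventually constant
    after pairing with [z]; coefficients of partial sums are of this kind. *)
Lemma inner_lim {T : Type} {F : set_system T} {FF : ProperFilter F}
    (u : T -> H) y z c :
  u @ F --> y -> (\forall t \near F, inner (u t) z = c) -> inner y z = c.
Proof.
move=> uy uc; apply/eqP; rewrite -subr_eq0 -normr_le0.
apply/ler_addgt0Pl => e e0; rewrite addr0.
have z1 : 0 < `|z| + 1 by rewrite ltr_wpDl.
have ez : 0 < e / (`|z| + 1) by rewrite divr_gt0.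
move/cvgrPdist_lt : uy => /(_ _ ez) uy.
have [t [<- ut]] := filter_ex (filterI uc uy).
rewrite -linearBl/=; apply: le_trans (inner_le_norm _ _) _.
apply: le_trans (_ : `|y - u t| * (`|z| + 1) <= e).
  by rewrite ler_wpM2l// lerDl.
by rewrite -ler_pdivlMr// ltW.
Qed.

Lemma norm_lim_le {T : Type} {F : set_system T} {FF : ProperFilter F}
    (u : T -> H) y (r : R[i]) :
  u @ F --> y -> (\forall t \near F, `|u t| <= r) -> `|y| <= r.
Proof.
move=> uy ur; apply/ler_addgt0Pl => e e0.
move/cvgrPdist_lt : uy => /(_ _ e0) uy.
have [t [tr ut]] := filter_ex (filterI ur uy).
rewrite -(subrK (u t) y); apply: le_trans (ler_normD _ _) _.
by rewrite lerD// ltW.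
Qed.

End inner_product.

(** * Orthonormal families and the Riesz-Fischer theorem *)

(** The family may vanish at the indices outside [P]. Allowing this makes
    finite families instances of sequences, with [P] an initial segment. *)
Definition orthonormal_on (R : realType) (H : hilbertType R) (P : pred nat)
    (f : nat -> H) :=
  forall i j, inner (f i) (f j) = ((i == j) && P i)%:R.

Section orthonormal_on.
Variables (R : realType) (H : hilbertType R) (P : pred nat) (f : nat -> H).
Hypothesis fP : orthonormal_on P f.
Implicit Types (x y : H) (a : nat -> R[i]).

Lemma orthonormal_on0 k : ~~ P k -> f k = 0.
Proof. by move=> Pk; apply: inner_self_eq0; rewrite fP (negbTE Pk) andbF. Qed.

Lemma coef_supp x k : ~~ P k -> inner x (f k) = 0.
Proof. by move=> /orthonormal_on0 ->; rewrite linear0r. Qed.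

Section combination.
Variable a : nat -> R[i].
Hypothesis aP : forall k, ~~ P k -> a k = 0.

Lemma inner_combination m n j :
  inner (\sum_(m <= k < n) a k *: f k) (f j) =
  if (m <= j < n)%N then a j else 0.
Proof.
rewrite linear_sumlz.
under eq_bigr => k _ do rewrite linearZl_LR/= fP.
case: ifPn => mjn.
  rewrite (bigD1_seq j) ?mem_index_iota ?iota_uniq//= eqxx/=.
  rewrite big1 ?addr0; last by move=> k /negbTE ->; rewrite mulr0.
  by have [|/aP ->] := boolP (P j); rewrite ?mulr1 ?mul0r.
rewrite big_nat_cond big1// => k /andP[mkn _].
by case: eqVneq => [kj|_]; rewrite ?mulr0//; rewrite -kj mkn in mjn.
Qed.

Lemma norm_combination m n :
  `|\sum_(m <= k < n) a k *: f k| ^+ 2 = \sum_(m <= k < n) `|a k| ^+ 2.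
Proof.
rewrite -inner_norm linear_sumr/= [LHS]big_nat_cond [RHS]big_nat_cond.
apply: eq_bigr => j /andP[mjn _].
by rewrite linearZr_LR/= inner_combination mjn mulrC -normCK.
Qed.

End combination.

Lemma bessel x n : \sum_(0 <= k < n) `|inner x (f k)| ^+ 2 <= `|x| ^+ 2.
Proof.
rewrite -(norm_combination (coef_supp x)).
set s := \sum_(_ <= _ < _) _.
have xs : inner (x - s) s = 0.
  rewrite {2}/s linear_sumr/= big_nat_cond big1// => j /andP[jn _].
  rewrite linearZr_LR/= linearBl/= inner_combination ?jn ?subrr ?mulr0//.
  exact: coef_supp.
by have := pythagoras xs; rewrite subrK => ->; rewrite lerDr exprn_ge0.
Qed.

(** Riesz-Fischer: by Pythagoras the partial sums of [a k *: f k] are Cauchy as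
    soon as those of [`|a k| ^+ 2] are, and the latter increase and are bounded.
    The bound is kept as a square so that it passes to the norm of the limit. *)
Lemma riesz_fischer a (r : R[i]) : 0 <= r -> (forall k, ~~ P k -> a k = 0) ->
  (forall n, \sum_(0 <= k < n) `|a k| ^+ 2 <= r ^+ 2) ->
  exists y : H, [/\ series (fun k => a k *: f k) @ \oo --> y,
    forall k, inner y (f k) = a k & `|y| <= r].
Proof.
move=> r0 aP ar.
have r2E : (complex.Re (r ^+ 2))%:C = r ^+ 2.
  by rewrite RRe_real// ger0_real// exprn_ge0.
(* Monotone convergence is about sequences of [R], so the squared moduli are
   moved from [R[i]] to [R]. *)
pose b k : R := complex.Re (`|a k| ^+ 2).
have bE k : (b k)%:C = `|a k| ^+ 2.
  by rewrite RRe_real// ger0_real// exprn_ge0.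
have b0 k : 0 <= b k by rewrite -lecR bE exprn_ge0.
have cvb : cvgn (series b).
  apply: nondecreasing_is_cvgn.
    by apply/nondecreasing_seqP => n; rewrite seriesSr lerDl.
  exists (complex.Re (r ^+ 2)) => _ [n _ <-].
  rewrite -lecR r2E rmorph_sum/=.
  by under eq_bigr => k _ do rewrite bE.
have cvs : cvg (series (fun k => a k *: f k) @ \oo).
  apply: cauchy_cvg; apply/cauchy_seriesP => e e0.
  have eE : (complex.Re e)%:C = e by rewrite RRe_real// ger0_real// ltW.
  have e20 : 0 < complex.Re e ^+ 2 by rewrite exprn_gt0// -ltcR eE.
  have [+ _] := @cauchy_seriesP R R^o b.
  move=> /(_ (@cvg_cauchy R^o _ _ cvb) _ e20).
  apply: filterS => -[m n]/= be.
  rewrite -ltr_sqr ?nnegrE ?(ltW e0)// norm_combination//.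
  have : (\sum_(m <= k < n) b k)%:C < (complex.Re e ^+ 2)%:C.
    by rewrite ltcR; apply: le_lt_trans be; exact: ler_norm.
  rewrite rmorph_sum rmorphXn/= eE.
  by under eq_bigr => k _ do rewrite bE.
exists (lim (series (fun k => a k *: f k) @ \oo)); split => //.
- move=> k; apply: inner_lim cvs _; exists k.+1 => // n /= kn.
  by rewrite /series/= inner_combination// kn.
- apply: norm_lim_le cvs _; apply: nearW => n.
  by rewrite -ler_sqr ?nnegrE// norm_combination.
Qed.

End orthonormal_on.

(** * Bounds on dimensions *)

Section dimension_bounds.
Variables (R : realType) (E : lmodType R[i]) (V W : set E).

Lemma dim_mod_ge n (v : 'I_n -> E) :
  (forall i, V (v i)) -> indep_mod W v -> (n%:R%:E <= dim_mod V W)%E.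
Proof. by move=> Vv iv; apply: ereal_sup_ubound; exists n => //; exists v. Qed.

(** If [n] vectors span [V], the coordinates of [m > n] vectors of [V] form an
    [m] by [n] matrix, and a nonzero vector in its kernel is a nontrivial
    relation between them. *)
Lemma dim_mod_le n (e : 'I_n -> E) :
  (forall x, V x -> exists c : 'I_n -> R[i], x = \sum_(i < n) c i *: e i) ->
  (dim_mod V [set 0%R] <= n%:R%:E)%E.
Proof.
move=> Ve; apply: ge_ereal_sup => _ [m [v Vv iv] <-].
rewrite lee_fin ler_nat leqNgt; apply/negP => nm.
have /choice[c cE] : forall i, exists c : 'I_n -> R[i],
    v i = \sum_(j < n) c j *: e j.
  by move=> i; exact: Ve.
pose A : 'M[R[i]]_(m, n) := \matrix_(i, j) c i j.
have : kermx A != 0.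
  by rewrite kermx_eq0 /row_free neq_ltn (leq_ltn_trans (rank_leq_col A) nm).
case/rowV0Pn => u /sub_kermxP uA /eqP; apply; apply/rowP => i; rewrite mxE.
apply: (iv (fun i => u 0 i)) => /=.
under eq_bigr => k _ do rewrite cE scaler_sumr.
rewrite exchange_big/= big1// => j _.
under eq_bigr => k _ do rewrite scalerA.
rewrite -scaler_suml.
have := congr1 (fun B : 'rV_n => B 0 j) uA; rewrite !mxE => uAj.
rewrite (_ : \sum_(k < m) _ = 0) ?scale0r// -[RHS]uAj.
by apply: eq_bigr => k _; rewrite mxE.
Qed.

End dimension_bounds.

Definition subspace (R : realType) (E : lmodType R[i]) (V : set E) :=
  V 0 /\ forall a x y, V x -> V y -> V (a *: x + y).

(** A linear map that induces an injection [V / W -> V' / W'] carries families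
    independent modulo [W] to families independent modulo [W']. *)
Lemma le_dim_mod_map (R : realType) (E F : lmodType R[i]) (V W : set E)
    (V' W' : set F) (f : {linear E -> F}) :
  subspace V -> (forall x, V x -> V' (f x)) ->
  (forall x, V x -> W' (f x) -> W x) -> (dim_mod V W <= dim_mod V' W')%E.
Proof.
move=> [V0 VD] VV' WW'; apply: ge_ereal_sup => _ [n [v Vv iv] <-].
apply: (dim_mod_ge (v := f \o v)) => [i|c /= Wc]; first exact: VV'.
apply: iv; apply: WW'.
  elim/big_ind: _ => [//|x y Vx Vy|i _].
    by rewrite -[x]scale1r; exact: VD.
  by rewrite -[_ *: _]addr0; exact: VD.
rewrite linear_sum/=; under eq_bigr => i _ do rewrite linearZ/=.
exact: Wc.
Qed.

(** * Gram-Schmidt orthonormalization *)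

(** When [V] is a closed subspace containing [g], this means that the span of
    [g] is dense in [V]. *)
Definition total_in (R : realType) (H : hilbertType R) (V : set H)
    (g : nat -> H) :=
  forall x, V x -> (forall n, inner x (g n) = 0) -> x = 0.

Section gram_schmidt.
Variables (R : realType) (H : hilbertType R) (g : nat -> H).

Definition residual (s : seq H) (x : H) : H :=
  x - \sum_(u <- s) inner x u *: u.

(** The process skips the vectors of [g] that depend linearly on the previous
    ones, instead of outputting [0] for them. Thus the nonzero vectors of the
    output come first, at the indices less than the dimension of the span. *)
Definition gs_next (s : seq H) : H :=
  if pselect (exists k, residual s (g k) != 0) is left ex then
    let r := residual s (g (ex_minn ex)) in `|r|^-1 *: r
  else 0.

Fixpoint gs_prefix (n : nat) : seq H :=
  if n is m.+1 then rcons (gs_prefix m) (gs_next (gs_prefix m)) else [::].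

Definition gs (n : nat) : H := gs_next (gs_prefix n).

Local Notation res n := (residual (gs_prefix n)).

Lemma residualS n x : res n.+1 x = res n x - inner x (gs n) *: gs n.
Proof. by rewrite /residual/= -cats1 big_cat big_seq1 opprD addrA. Qed.

Lemma residualE n x : x = \sum_(0 <= k < n) inner x (gs k) *: gs k + res n x.
Proof.
elim: n => [|n IHn]; first by rewrite big_geq// add0r /residual big_nil subr0.
by rewrite residualS big_nat_recr//= addrACA subrr addr0.
Qed.

Variant gs_spec n : H -> Prop :=
| GsNew k of res n (g k) != 0 & (forall j, (j < k)%N -> res n (g j) = 0) :
    gs_spec n (`|res n (g k)|^-1 *: res n (g k))
| GsEnd of (forall k, res n (g k) = 0) : gs_spec n 0.

Lemma gsP n : gs_spec n (gs n).
Proof.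
rewrite /gs /gs_next; case: pselect => [ex|nex].
  case: ex_minnP => k rk kmin; apply: GsNew => // j jk.
  apply/eqP/negP => /negP rj.
  by have := kmin _ rj; rewrite leqNgt jk.
by apply: GsEnd => k; apply/eqP/negP => /negP rk; apply: nex; exists k.
Qed.

Lemma gs_norm n : inner (gs n) (gs n) = (gs n != 0)%:R.
Proof.
case: gsP => [k rk _|]; last by rewrite linear0l eqxx.
rewrite inner_norm normrZ normfV normr_id mulVf ?normr_eq0// expr1n.
by rewrite scaler_eq0 invr_eq0 normr_eq0 orbb rk.
Qed.

Lemma gs_mul_norm x n : inner x (gs n) * inner (gs n) (gs n) = inner x (gs n).
Proof.
by rewrite gs_norm; case: eqVneq => [->|_]; rewrite ?linear0r ?mul0r ?mulr1.
Qed.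

(** By strong induction: the vectors before [gs n] being mutually orthogonal,
    residuals at stage [n], among which [gs n] up to scaling, are orthogonal to
    all of them. *)
Lemma gs_orthogonal i j : i != j -> inner (gs i) (gs j) = 0.
Proof.
suff low n : forall j, (j < n)%N -> inner (gs n) (gs j) = 0.
  rewrite neq_ltn => /orP[ij|]; last exact: low.
  by apply: inner_eq0C; exact: low.
elim/ltn_ind: n => n IH {}j jn.
have res0 x : inner (res n x) (gs j) = 0.
  have := congr1 (fun y => inner y (gs j)) (residualE n x).
  rewrite /= linearDl/= linear_sumlz/=.
  rewrite (bigD1_seq j) ?mem_index_iota ?iota_uniq//=.
  rewrite big_nat_cond big1 => [|k /andP[kn kj]].
    rewrite linearZl_LR/= gs_mul_norm addr0 -[LHS]addr0.
    by move/addrI.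
  rewrite linearZl_LR/=; apply/eqP; rewrite mulf_eq0; apply/orP; right.
  apply/eqP.
  case: (ltngtP k j) kj => // kj _; last exact: IH.
  by apply: inner_eq0C; exact: IH.
by case: gsP => [k _ _|_]; rewrite ?linear0l// linearZl_LR/= res0 mulr0.
Qed.

Lemma gs_orthonormal : orthonormal_on [pred n | gs n != 0] gs.
Proof.
move=> i j; have [<-|ij] := eqVneq i j; first exact: gs_norm.
exact: gs_orthogonal.
Qed.

Lemma residual_perp n x j : (j < n)%N -> inner (res n x) (gs j) = 0.
Proof.
move=> jn; have := congr1 (fun y => inner y (gs j)) (residualE n x).
rewrite /= linearDl/= (inner_combination gs_orthonormal); last first.
  by move=> k; exact: (coef_supp gs_orthonormal).
by rewrite jn -[LHS]addr0 => /addrI.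
Qed.

Lemma inner_residual n x : inner (res n x) (gs n) = inner x (gs n).
Proof.
have := congr1 (fun y => inner y (gs n)) (residualE n x).
rewrite /= linearDl/= (inner_combination gs_orthonormal) ?ltnn ?add0r// => k.
exact: (coef_supp gs_orthonormal).
Qed.

Lemma gs_eq0P n : gs n = 0 <-> forall k, res n (g k) = 0.
Proof.
case: gsP => // k rk _; split=> [/eqP|/(_ k) r0]; last by rewrite r0 eqxx in rk.
by rewrite scaler_eq0 invr_eq0 normr_eq0 orbb (negbTE rk).
Qed.

Lemma residual_eq0S n x : res n x = 0 -> res n.+1 x = 0.
Proof.
by move=> r0; rewrite residualS -inner_residual r0 linear0l scale0r subr0.
Qed.

(** Stage [n] treats the first [g k] with a nonzero residual, hence [g n] at the
    latest. *)
Lemma residual_eq0 n k : (k < n)%N -> res n (g k) = 0.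
Proof.
elim: n k => // n IHn k.
rewrite ltnS leq_eqVlt => /orP[/eqP->|/IHn]; last first.
  exact: residual_eq0S.
have [r0|rn] := eqVneq (res n (g n)) 0; first exact: residual_eq0S.
rewrite residualS -inner_residual.
case: gsP => [{}k rk kmin|/(_ n) r0]; last by rewrite r0 eqxx in rn.
have kn : k = n.
  apply/eqP; rewrite eqn_leq.
  apply/andP; split; rewrite leqNgt; apply/negP => lt.
    by rewrite kmin ?eqxx in rn.
  by rewrite IHn ?eqxx in rk.
subst k; rewrite linearZr_LR/= inner_norm scalerA.
rewrite geC0_conj ?invr_ge0//.
by rewrite mulrAC -expr2 -exprMn mulVf ?normr_eq0// expr1n scale1r subrr.
Qed.

Lemma gs_stop k n : (k <= n)%N -> gs k = 0 -> gs n = 0.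
Proof.
move=> + /gs_eq0P rk; elim: n => [|n IHn].
  by rewrite leqn0 => /eqP k0; apply/gs_eq0P; rewrite -k0.
rewrite leq_eqVlt => /orP[/eqP <-|/IHn/gs_eq0P rn]; first exact/gs_eq0P.
by apply/gs_eq0P => j; exact: residual_eq0S.
Qed.

Section in_subspace.
Variable V : set H.
Hypotheses (sV : subspace V) (Vg : forall n, V (g n)) (tg : total_in V g).

Lemma subspace_sum a n (u : nat -> H) :
  (forall k, (k < n)%N -> V (u k)) -> V (\sum_(0 <= k < n) a k *: u k).
Proof.
case: sV => V0 VD; elim: n => [|n IHn] Vu; first by rewrite big_geq.
rewrite big_nat_recr//= addrC; apply: VD; first exact: Vu.
by apply: IHn => k kn; apply: Vu; rewrite ltnS ltnW.
Qed.

Lemma residual_mem n x :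
  (forall k, (k < n)%N -> V (gs k)) -> V x -> V (res n x).
Proof.
move=> Vgs Vx; case: sV => V0 VD.
rewrite (_ : res n x = -1 *: (\sum_(0 <= k < n) inner x (gs k) *: gs k) + x).
  by apply: VD => //; exact: subspace_sum.
by rewrite [in X in _ = _ + X](residualE n x) scaleN1r addKr.
Qed.

Lemma gs_mem n : V (gs n).
Proof.
elim/ltn_ind: n => n IH; case: gsP => [k _ _|_]; last by case: sV.
rewrite -[X in V X]addr0; case: sV => V0; apply => //.
exact: residual_mem.
Qed.

(** Each [g k] is a combination of [gs 0], ..., [gs k]. *)
Lemma gs_total : total_in V gs.
Proof.
move=> x Vx xgs; apply: tg Vx _ => k.
rewrite (residualE k.+1 (g k)) residual_eq0// addr0 linear_sumr/= big1// => j _.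
by rewrite linearZr_LR/= xgs mulr0.
Qed.

(** If [gs n] vanishes, the first [n] vectors span the subspace, so its
    dimension is at most [n]; otherwise the first [n + 1] vectors are
    independent. *)
Lemma gs_neq0 n : (gs n != 0) = (n%:R%:E < dim_mod V [set 0%R])%E.
Proof.
apply/idP/idP => [gn|]; last first.
  apply: contraTneq => /gs_eq0P rg; rewrite -leNgt.
  apply: (dim_mod_le (e := fun i : 'I_n => gs i)).
  move=> x Vx; exists (fun i => inner x (gs i)).
  rewrite -(big_mkord xpredT (fun i => inner x (gs i) *: gs i)).
  rewrite [LHS](residualE n x).
  suff -> : res n x = 0 by rewrite addr0.
  apply: tg => [|k]; first by apply: residual_mem => // j _; exact: gs_mem.
  rewrite (residualE n (g k)) rg addr0 linear_sumr/= big_nat_cond.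
  rewrite big1// => j /andP[jn _].
  by rewrite linearZr_LR/= residual_perp ?mulr0.
apply: lt_le_trans (_ : (n.+1%:R%:E <= _)%E); first by rewrite lte_fin ltr_nat.
have gk k : (k <= n)%N -> gs k != 0.
  by move=> kn; apply: contraNneq gn => /(gs_stop kn) ->.
apply: (dim_mod_ge (v := fun i : 'I_n.+1 => gs i)) => [i|c /= c0 i].
  exact: gs_mem.
have := congr1 (fun y => inner y (gs i)) c0.
rewrite linear0l linear_sumlz/= (bigD1 i)//= big1 => [|j ji].
  by rewrite linearZl_LR/= gs_norm gk ?mulr1 ?addr0// -ltnS.
by rewrite linearZl_LR/= gs_orthogonal ?mulr0.
Qed.

End in_subspace.
End gram_schmidt.

(** * Bounded operators *)

Section bounded_operators.
Variable R : realType.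
Implicit Types H K L : hilbertType R.

Lemma bounded_continuous H K (T : {linear H -> K}) :
  bounded_ops H K T -> continuous T.
Proof.
move=> [M TM]; apply: bounded_linear_continuous; apply/linear_boundedP.
exists M%:C; split=> [|r Mr x].
  by rewrite complex_real.
by apply: le_trans (TM x) _; rewrite ler_wpM2r// ltW.
Qed.

Lemma bounded_comp H K L (S : {linear K -> L}) (T : {linear H -> K}) :
  bounded_ops K L S -> bounded_ops H K T -> bounded_ops H L (S \o T).
Proof.
move=> [M SM] [N TN]; exists (`|M| * N) => x.
have MM : M%:C <= `|M|%:C by rewrite lecR ler_norm.
apply: le_trans (SM _) _; apply: le_trans (_ : `|M|%:C * `|T x| <= _).
  by rewrite ler_wpM2r.
by rewrite rmorphM -mulrA ler_wpM2l ?lecR.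
Qed.

Lemma bounded_add H K (S T : {linear H -> K}) :
  bounded_ops H K S -> bounded_ops H K T -> bounded_ops H K (S \+ T).
Proof.
move=> [M SM] [N TN]; exists (M + N) => x.
by rewrite rmorphD mulrDl; apply: le_trans (ler_normD _ _) _; exact: lerD.
Qed.

Lemma bounded_sub H K (S T : {linear H -> K}) :
  bounded_ops H K S -> bounded_ops H K T -> bounded_ops H K (S \- T).
Proof.
move=> [M SM] [N TN]; exists (M + N) => x.
by rewrite rmorphD mulrDl; apply: le_trans (ler_normB _ _) _; exact: lerD.
Qed.

Lemma bounded_id H : bounded_ops H H idfun.
Proof. by exists 1 => x; rewrite mul1r. Qed.

Lemma bounded_scale_id H (l : R[i]) : bounded_ops H H (l \*: idfun).
Proof.
by exists (complex.Re `|l|) => x; rewrite RRe_real// -normrZ.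
Qed.

Lemma closed_fixed H (Q : {linear H -> H}) :
  bounded_ops H H Q -> closed [set x | Q x = x].
Proof.
move=> bQ; rewrite (_ : [set _ | _] = (Q \- idfun) @^-1` [set 0]).
  apply: closed_comp => [x _|]; last first.
    exact/accessible_closed_set1/hausdorff_accessible/norm_hausdorff.
  by apply: bounded_continuous; apply: bounded_sub => //; exact: bounded_id.
by apply/seteqP; split=> x /=; [move=> ->; rewrite subrr|move/subr0_eq].
Qed.

Lemma subspace_fixed H (Q : {linear H -> H}) : subspace [set x | Q x = x].
Proof.
by split=> [|a x y /= Qx Qy]; rewrite /= ?linear0// linearP/= Qx Qy.
Qed.

End bounded_operators.

(** * Orthonormal bases and isomorphisms of Hilbert spaces *)

Section hilbert_basis.
Variable R : realType.

Definition hilbert_basis (H : hilbertType R) (V : set H) (e : nat -> H) :=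
  [/\ orthonormal_on [pred n | (n%:R%:E < dim_mod V [set 0%R])%E] e,
      forall n, V (e n) & total_in V e].

(** The images under [Q] of a dense sequence are dense in the range of [Q], and
    a vector of the range orthogonal to vectors arbitrarily close to it is [0].
    Going through [Q] spares a proof that subspaces inherit separability. *)
Lemma separable_total (H : hilbertType R) (Q : {linear H -> H}) :
  separable H -> bounded_ops H H Q -> (forall x, Q (Q x) = Q x) ->
  exists g : nat -> H,
    (forall n, Q (g n) = g n) /\ total_in [set x | Q x = x] g.
Proof.
move=> [D cD dD] bQ QQ.
have [d dE] : exists d : nat -> H, D `<=` range d.
  have /pfcard_geP[->|[d]] := cD; first by exists (fun=> 0).
  by exists d; exact: surj.
exists (Q \o d); split=> [n|x /= Qx xd]; first by rewrite /= QQ.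
have xQ0 z : D z -> inner x (Q z) = 0 by move=> /dE[n _ <-]; exact: xd.
apply/eqP; rewrite -normr_le0; apply/ler_addgt0Pl => e e0; rewrite addr0.
have /cvgrPdist_lt/(_ _ e0)/nbhs_interior xe : Q @ x --> Q x.
  exact: bounded_continuous.
have [z [/interior_subset ze Dz]] :=
  dD _ (ex_intro _ _ (nbhs_singleton xe)) (open_interior _).
rewrite /= Qx in ze.
have [->|x0] := eqVneq x 0; first by rewrite normr0 ltW.
have : `|x| * `|x| <= `|x| * e.
  rewrite -expr2 -inner_norm.
  rewrite -[X in inner x X](subrK (Q z)) linearDr/= xQ0// addr0.
  rewrite -(ger0_norm (_ : 0 <= inner x (x - Q z))).
    apply: le_trans (inner_le_norm _ _) _.
    by rewrite ler_wpM2l// ltW.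
  have : inner x x = inner x (x - Q z) by rewrite linearBr/= xQ0// subr0.
  by move=> <-; rewrite inner_norm exprn_ge0.
by rewrite ler_pM2l ?normr_gt0.
Qed.

Lemma ex_hilbert_basis (H : hilbertType R) (Q : {linear H -> H}) :
  separable H -> bounded_ops H H Q -> (forall x, Q (Q x) = Q x) ->
  exists e : nat -> H, hilbert_basis [set x | Q x = x] e.
Proof.
move=> sH bQ QQ; have [g [Qg tg]] := separable_total sH bQ QQ.
have sQ := subspace_fixed Q; exists (gs g); split.
- move=> i j; rewrite gs_orthonormal; congr (_ && _)%:R.
  exact: (gs_neq0 sQ Qg tg).
- exact: (gs_mem sQ Qg).
- exact: (gs_total tg).
Qed.

Section transfer.
Variables (H K : hilbertType R) (V : set K) (W : set H).
Variables (e : nat -> K) (f : nat -> H).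
Hypotheses (sW : subspace W) (cW : closed W).
Hypotheses (Ve : hilbert_basis V e) (Wf : hilbert_basis W f).
Hypothesis dimVW : dim_mod V [set 0] = dim_mod W [set 0].

Lemma same_coefs_eq x y : W x -> W y ->
  (forall n, inner x (f n) = inner y (f n)) -> x = y.
Proof.
case: Wf sW => _ _ tf [_ WD] Wx Wy xy; apply/esym/eqP.
rewrite -subr_eq0; apply/eqP; apply: tf => [|n].
  by rewrite addrC -scaleN1r; apply: WD.
by rewrite linearBl/= xy subrr.
Qed.

(** Riesz-Fischer gives [T x], whose coefficients are square-summable by
    Bessel's inequality for [x]. Linearity is a consequence of uniqueness. *)
Lemma ex_transfer : exists2 T : {linear K -> H}, bounded_ops K H T &
  forall x, W (T x) /\ forall n, inner (T x) (f n) = inner x (e n).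
Proof.
have [eP _ _] := Ve; have [fP Wf' _] := Wf.
have /choice[t tE] : forall x, exists y, [/\ `|y| <= `|x|, W y &
    forall n, inner y (f n) = inner x (e n)].
  move=> x; rewrite -dimVW in fP.
  have [y [sy yf yx]] :=
    riesz_fischer fP (normr_ge0 x) (coef_supp eP x) (bessel eP x).
  exists y; split=> //; apply: closed_cvg cW _ _ sy.
  apply: nearW => n; apply: subspace_sum => // k _; exact: Wf'.
have tL : linear t.
  move=> a x y.
  case: (tE x) (tE y) (tE (a *: x + y)) => [_ Wx xE] [_ Wy yE] [_ Wxy xyE].
  apply: same_coefs_eq => // [|n]; first by case: sW => _; apply.
  by rewrite xyE !linearDl/= !linearZl_LR/= xE yE.
pose T : {linear K -> H} := HB.pack t (GRing.isLinear.Build _ _ _ _ t tL).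
exists T => [|x]; last by case: (tE x).
by exists 1 => x; rewrite mul1r; case: (tE x).
Qed.

End transfer.

(** The subspaces are given as ranges of projections, and the isomorphisms are
    defined on the whole spaces, where they can be composed with the projections
    and with other operators. They invert each other on the subspaces because
    composing them preserves all the coefficients. *)
Lemma ex_isomorphism (H K : hilbertType R) (P : {linear H -> H})
    (Q : {linear K -> K}) :
  separable H -> separable K -> bounded_ops H H P -> bounded_ops K K Q ->
  (forall x, P (P x) = P x) -> (forall y, Q (Q y) = Q y) ->
  dim_mod [set y | Q y = y] [set 0] = dim_mod [set x | P x = x] [set 0] ->
  exists T : {linear K -> H}, exists S : {linear H -> K},
  [/\ bounded_ops K H T, bounded_ops H K S,
      forall y, P (T y) = T y, forall x, Q (S x) = S x &
      (forall y, Q y = y -> S (T y) = y) /\ (forall x, P x = x -> T (S x) = x)].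
Proof.
move=> sH sK bP bQ PP QQ dimQP.
have [e Qe] := ex_hilbert_basis sK bQ QQ.
have [f Pf] := ex_hilbert_basis sH bP PP.
have [T bT TE] :=
  ex_transfer (subspace_fixed P) (closed_fixed bP) Qe Pf dimQP.
have [S bS SE] :=
  ex_transfer (subspace_fixed Q) (closed_fixed bQ) Pf Qe (esym dimQP).
exists T, S; split=> //; [by move=> y; case: (TE y)|by move=> x; case: (SE x)|].
split=> [y Qy|x Px].
  apply: (same_coefs_eq (subspace_fixed Q) Qe) => // [|n].
    by case: (SE (T y)).
  by rewrite (SE _).2 (TE _).2.
apply: (same_coefs_eq (subspace_fixed P) Pf) => // [|n].
  by case: (TE (S x)).
by rewrite (TE _).2 (SE _).2.
Qed.

Lemma ex_invertible (H K : hilbertType R) :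
  infinite_dimensional H -> infinite_dimensional K ->
  separable H -> separable K ->
  exists U : {linear K -> H}, exists V : {linear H -> K},
    [/\ bounded_ops K H U, bounded_ops H K V, cancel U V & cancel V U].
Proof.
move=> infH infK sH sK.
have [| | | | |T [S [bT bS _ _ [ST TS]]]] :=
  @ex_isomorphism H K idfun idfun sH sK; do ?exact: bounded_id; do ?by [].
  have fixT (L : hilbertType R) : [set x : L | idfun x = x] = setT.
    by apply/seteqP; split.
  by rewrite !fixT [LHS]infK [RHS]infH.
by exists T, S; split=> // x; [exact: ST|exact: TS].
Qed.

End hilbert_basis.

(** * Kernels, blocks, and invertibility of the block operator *)

Lemma subspace_ker (R : realType) (H K : hilbertType R) (T : {linear H -> K}) :
  subspace (ker T).
Proof.
split=> [|a x y Tx Ty]; first exact: linear0.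
by rewrite /ker/= linearP Tx Ty scaler0 addr0.
Qed.

Section block_maps.
Variables (R : realType) (H K : hilbertType R).

Definition in1 (x : H) : hsum H K := (x, 0).
Definition in2 (y : K) : hsum H K := (0, y).
Definition pr1 (z : hsum H K) : H := z.1.
Definition pr2 (z : hsum H K) : K := z.2.

Lemma in1_linear : linear in1.
Proof.
by move=> a x y; congr (_, _); rewrite /= scaler0 addr0.
Qed.

Lemma in2_linear : linear in2.
Proof.
by move=> a x y; congr (_, _); rewrite /= scaler0 addr0.
Qed.

Lemma pr1_linear : linear pr1. Proof. by []. Qed.
Lemma pr2_linear : linear pr2. Proof. by []. Qed.

HB.instance Definition _ :=
  GRing.isLinear.Build R[i] H (hsum H K) *:%R in1 in1_linear.
HB.instance Definition _ :=
  GRing.isLinear.Build R[i] K (hsum H K) *:%R in2 in2_linear.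
HB.instance Definition _ :=
  GRing.isLinear.Build R[i] (hsum H K) H *:%R pr1 pr1_linear.
HB.instance Definition _ :=
  GRing.isLinear.Build R[i] (hsum H K) K *:%R pr2 pr2_linear.

Lemma bounded_in1 : bounded_ops H (hsum H K) in1.
Proof.
exists 1 => x; rewrite mul1r; apply: le_trans (hsum_norm_le _) _.
by rewrite normr0 addr0.
Qed.

Lemma bounded_in2 : bounded_ops K (hsum H K) in2.
Proof.
exists 1 => x; rewrite mul1r; apply: le_trans (hsum_norm_le _) _.
by rewrite normr0 add0r.
Qed.

Lemma bounded_pr1 : bounded_ops (hsum H K) H pr1.
Proof. by exists 1 => z; rewrite mul1r; exact: hsum_norm1. Qed.

Lemma bounded_pr2 : bounded_ops (hsum H K) K pr2.
Proof. by exists 1 => z; rewrite mul1r; exact: hsum_norm2. Qed.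

End block_maps.

Section upper_triangular_invertibility.
Variables (R : realType) (H K : hilbertType R).
Variables (A : {linear H -> H}) (B : {linear K -> K}).

Lemma shift_upper_op (C : {linear K -> H}) (l : R[i]) :
  shift_op (upper_op A C B) l =
  upper_op (shift_op A l) C (shift_op B l) :> (hsum H K -> hsum H K).
Proof.
apply/funext => -[x y]; rewrite /shift_op/upper_op/=.
by congr (_, _); rewrite /= addrAC.
Qed.

(** From [M_C (x, y) = (A x + C y, B y)]: when [B y = 0] and [C y = A x], the
    vector [(- x, y)] is in the kernel of [M_C], so [C] is injective from
    [ker B] to the quotient by [range A]. When [M_C (x, y) = (h, 0)], [y] is in
    [ker B] and [h - C y] in [range A]; the bound in the other direction uses
    the linear map [h |-> y]. *)
Lemma upper_op_invertible (C : {linear K -> H}) : invertible (upper_op A C B) ->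
  [/\ left_invertible A, right_invertible B & nullity B = defect A].
Proof.
move=> [N bN [NM MN]].
have NME z : N (upper_op A C B z) = z := congr1 (fun f => f z) NM.
have MNE z : upper_op A C B (N z) = z := congr1 (fun f => f z) MN.
split.
- exists (@pr1 R H K \o (N \o @in1 R H K)).
    exact/bounded_comp/bounded_comp/bounded_in1/bN/bounded_pr1.
  apply/funext => x /=.
  rewrite (_ : in1 K (A x) = upper_op A C B (in1 K x)) ?NME//.
  by rewrite /upper_op/= !linear0 addr0.
- exists (@pr2 R H K \o (N \o @in2 R H K)).
    exact/bounded_comp/bounded_comp/bounded_in2/bN/bounded_pr2.
  by apply/funext => y /=; have /(congr1 snd) := MNE (in2 H y).
apply/eqP; rewrite eq_le; apply/andP; split.
- apply: (le_dim_mod_map (f := C)) => // [|y /= By [x _ AC]].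
    exact: subspace_ker.
  have : upper_op A C B (- x, y) = 0.
    by rewrite /upper_op/= linearN AC addNr By.
  by move=> /(congr1 N); rewrite NME linear0 => -[].
- apply: (le_dim_mod_map (f := @pr2 R H K \o (N \o @in1 R H K))) =>
    // [h _|h _ /= h0].
    by have /(congr1 snd) := MNE (in1 K h).
  have := congr1 fst (MNE (in1 K h)); rewrite /upper_op/=.
  by rewrite -/(pr2 _) h0 linear0 addr0 => <-; exists (N (in1 K h)).1.
Qed.

End upper_triangular_invertibility.

(** * Completion to an invertible operator *)

Section completion.
Variables (R : realType) (H K : hilbertType R).

(** [C] maps the decomposition [K = range B1 + ker B] to [H = range A + ker A1]:
    [B1 k] goes to [A (U k)], and [ker B] goes isomorphically onto [ker A1],
    which represents [H / range A]. *)
Lemma ex_invertible_completion (A : {linear H -> H}) (B : {linear K -> K}) :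
  infinite_dimensional H -> infinite_dimensional K ->
  separable H -> separable K ->
  bounded_ops H H A -> bounded_ops K K B ->
  left_invertible A -> right_invertible B -> nullity B = defect A ->
  exists2 C : {linear K -> H},
    invertible_ops K H C & invertible (upper_op A C B).
Proof.
move=> infH infK sH sK bA bB [A1 bA1 A1A] [B1 bB1 BB1] dimBA.
have A1AE x : A1 (A x) = x := congr1 (fun f => f x) A1A.
have BB1E y : B (B1 y) = y := congr1 (fun f => f y) BB1.
(* The projections are kept opaque: only their defining equations and the
   relations derived from them are used. *)
have [P bP PE] : exists2 P : {linear H -> H}, bounded_ops H H P &
    forall x, P x = x - A (A1 x).
  exists (idfun \- (A \o A1)) => //.
  exact/bounded_sub/bounded_comp/bA1/bA/bounded_id.
have [Q bQ QE] : exists2 Q : {linear K -> K}, bounded_ops K K Q &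
    forall y, Q y = y - B1 (B y).
  exists (idfun \- (B1 \o B)) => //.
  exact/bounded_sub/bounded_comp/bB/bB1/bounded_id.
have PA x : P (A x) = 0 by rewrite PE A1AE subrr.
have QB1 y : Q (B1 y) = 0 by rewrite QE BB1E subrr.
have PP x : P (P x) = P x by rewrite [X in P X]PE linearB/= PA subr0.
have QQ y : Q (Q y) = Q y by rewrite [X in Q X]QE linearB/= QB1 subr0.
have A1P x : A1 (P x) = 0 by rewrite PE linearB/= A1AE subrr.
have BQ y : B (Q y) = 0 by rewrite QE linearB/= BB1E subrr.
have sumP x : A (A1 x) + P x = x by rewrite PE addrC subrK.
have sumQ y : B1 (B y) + Q y = y by rewrite QE addrC subrK.
have dimQ : dim_mod [set y | Q y = y] [set 0] = nullity B.
  congr dim_mod; apply/seteqP; split=> y; rewrite /ker/= => yE.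
    by rewrite -yE BQ.
  by rewrite QE yE linear0 subr0.
(* The range of [P] is a complement of the range of [A]. *)
have dimP : dim_mod [set x | P x = x] [set 0] = defect A.
  apply/eqP; rewrite eq_le; apply/andP; split.
    apply: (le_dim_mod_map (f := idfun)) => // [|w Pw [x _ /= Ax]].
      exact: subspace_fixed.
    by rewrite -Pw -Ax PA.
  apply: (le_dim_mod_map (f := P)) => // [x _|x _ /= Px]; first exact: PP.
  by exists (A1 x) => //; rewrite -[RHS]sumP Px addr0.
have [T [S [bT bS PT QS [ST TS]]]] :=
  ex_isomorphism sH sK bP bQ PP QQ (etrans dimQ (etrans dimBA (esym dimP))).
have [U [U1 [bU bU1 U1U UU1]]] := ex_invertible infH infK sH sK.
have A1T y : A1 (T y) = 0 by rewrite -PT A1P.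
have BS x : B (S x) = 0 by rewrite -QS BQ.
have STQ y : S (T (Q y)) = Q y by rewrite ST.
have TSP x : T (S (P x)) = P x by rewrite TS.
have [C bC CE] : exists2 C : {linear K -> H}, bounded_ops K H C &
    forall y, C y = A (U (B y)) + T (Q y).
  exists ((A \o (U \o B)) \+ (T \o Q)) => //.
  by apply: bounded_add; [do 2?apply: bounded_comp|exact: bounded_comp].
have A1C y : A1 (C y) = U (B y) by rewrite CE linearD/= A1AE A1T addr0.
have PC y : P (C y) = T (Q y) by rewrite CE linearD/= PA PT add0r.
exists C.
  split=> //; exists ((B1 \o (U1 \o A1)) \+ (S \o P)).
    by apply: bounded_add; [do 2?apply: bounded_comp|exact: bounded_comp].
  split; apply/funext => x /=; first by rewrite A1C U1U PC STQ sumQ.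
  rewrite CE (linearD B) (linearD Q)/= BB1E BS addr0 UU1 QB1 add0r QS TSP.
  exact: sumP.
exists ((@in1 R H K \o ((A1 \o @pr1 R H K) \- (U \o @pr2 R H K))) \+
        (@in2 R H K \o ((B1 \o @pr2 R H K) \+ (S \o (P \o @pr1 R H K))))).
  have bpr1 := @bounded_pr1 R H K; have bpr2 := @bounded_pr2 R H K.
  apply: bounded_add; apply: bounded_comp.
  - exact: bounded_in1.
  - by apply: bounded_sub; exact: bounded_comp.
  - exact: bounded_in2.
  - by apply: bounded_add; do 2?apply: bounded_comp.
split; apply/funext => -[x y]; rewrite /= /in1 /in2 /pr1 /pr2 /upper_op /=.
  congr (_, _) => /=.
    by rewrite linearD/= A1AE A1C addrK addr0.
  by rewrite linearD/= PA PC !add0r STQ sumQ.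
congr (_, _) => /=; last by rewrite add0r linearD/= BB1E BS addr0.
rewrite addr0 add0r CE (linearD B) (linearD Q)/= BB1E BS addr0 QB1 add0r QS TSP.
by rewrite linearB/= addrA subrK sumP.
Qed.

End completion.

(** * The intersections of spectra *)

Lemma invertible_fredholm (R : realType) (H K : hilbertType R) :
  invertible_ops H K `<=` fredholm_ops H K.
Proof.
move=> T [bT [S _ [ST TS]]].
have STE x : S (T x) = x := congr1 (fun f => f x) ST.
have TSE y : T (S y) = y := congr1 (fun f => f y) TS.
have rT : range T = setT by apply/seteqP; split=> // y _; exists (S y).
have lt0 : (0%:R%:E < +oo :> \bar R)%E by rewrite ltry.
split=> //; rewrite ?rT; first exact: closedT.
- apply: le_lt_trans lt0; apply: (dim_mod_le (e := fun _ : 'I_0 => 0)) => x Tx.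
  by exists (fun=> 0); rewrite big_ord0 -[x]STE Tx linear0.
- rewrite /defect rT; apply: le_lt_trans lt0.
  apply: le_trans (_ : (dim_mod [set 0%R : K] [set 0%R] <= _)%E).
    by apply: (le_dim_mod_map (f := \0 : {linear K -> K})).
  apply: (dim_mod_le (e := fun _ : 'I_0 => 0)) => _ ->.
  by exists (fun=> 0); rewrite big_ord0.
Qed.

Unset Implicit Arguments.

Theorem theorem3 (R : realType) (H K : hilbertType R)
    (infH : infinite_dimensional H) (infK : infinite_dimensional K)
    (sepH : separable H) (sepK : separable K)
    (A : {linear H -> H}) (B : {linear K -> K})
    (bA : bounded_ops H H A) (bB : bounded_ops K K B) :
  [/\ \bigcap_(C in fredholm_ops K H) spectrum (upper_op A C B) =
        \bigcap_(C in invertible_ops K H) spectrum (upper_op A C B),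
      \bigcap_(C in invertible_ops K H) spectrum (upper_op A C B) =
        \bigcap_(C in bounded_ops K H) spectrum (upper_op A C B) &
      \bigcap_(C in bounded_ops K H) spectrum (upper_op A C B) =
        left_spectrum A `|` right_spectrum B `|`
        [set l : R[i] | nullity (shift_op B l) <> defect (shift_op A l)]].
Proof.
have spE C l : spectrum (upper_op A C B) l =
    ~ invertible (upper_op (shift_op A l) C (shift_op B l)).
  by rewrite /spectrum/= /invertible shift_upper_op.
set sigB := \bigcap_(C in bounded_ops K H) _.
set sigF := \bigcap_(C in fredholm_ops K H) _.
set sigI := \bigcap_(C in invertible_ops K H) _.
set rhs := _ `|` _.
have BF : sigB `<=` sigF by move=> l lB C [bC _ _ _]; exact: lB.
have FI : sigF `<=` sigI by move=> l lF C /invertible_fredholm; exact: lF.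
have rB : rhs `<=` sigB.
  move=> l rl C bC; rewrite spE => /upper_op_invertible[lA rBl dimBA].
  by case: rl => [[]|].
have Ir : sigI `<=` rhs.
  move=> l lI; apply: contrapT => /not_orP[/not_orP[]].
  rewrite /left_spectrum /right_spectrum /=.
  move=> /contrapT lA /contrapT rBl /contrapT dimBA.
  have bs (L : hilbertType R) (T : {linear L -> L}) :
      bounded_ops L L T -> bounded_ops L L (shift_op T l).
    by move=> bT; exact/bounded_sub/bounded_scale_id.
  have [C iC] := ex_invertible_completion infH infK sepH sepK
    (bs _ _ bA) (bs _ _ bB) lA rBl dimBA.
  by have := lI C iC; rewrite spE.
have IB := subset_trans Ir rB.
split; apply/seteqP; split=> //; [|exact: subset_trans BF FI|].
- exact: subset_trans IB BF.
- exact: subset_trans BF (subset_trans FI Ir).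
Qed.
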